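(* Let $G$ be a connected unweighted graph of order $n\ge2$, and let $H$ be a connected spanning subgraph of $G$ obtained by deleting $r\le n-1$ edges. If $\mu_1\ge\cdots\ge\mu_n=0$ and $\theta_1\ge\cdots\ge\theta_n=0$ are the eigenvalues of the normalized Laplacian matrices $\mathcal L_G$ and $\mathcal L_H$, respectively, then $$\frac{r}{\mu_1}+\sum_{j=1}^{n-r-1}\frac{1}{\theta_j}\ \le\ K(G)\ \le\ \sum_{j=r+1}^{n-1}\frac{1}{\theta_j}+\frac{r}{\mu_{n-1}}.$$
   Context: Graphs are finite, simple, connected and undirected, with $n$ vertices; unweighted means all edge weights are $1$. For a graph $G$ with adjacency matrix $A$ and diagonal degree matrix $D$, the normalized Laplacian is $\mathcal L_G=I-D^{-1/2}AD^{-1/2}$; for connected $G$ its eigenvalue $0$ is simple. (The normalized Laplacian of $H$ uses the degrees in $H$.) Empty sums are $0$. Kemeny's constant is $K(G)=\sum_i\pi_i m_{ji}-1$ for the random walk with transition matrix $D^{-1}A$, where $\pi$ is the stationary distribution and $m_{ji}$ the mean first passage time from $j$ to $i$ (with $m_{jj}$ the mean first return time); this does not depend on $j$, and it is known that $K(G)=\sum_{j=1}^{n-1}\frac{1}{\mu_j}$, where $\mu_1\ge\cdots\ge\mu_{n-1}>\mu_n=0$ are the eigenvalues of $\mathcal L_G$. *)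

(* Defs.v *)
From mathcomp Require Import all_boot all_order all_algebra.
From mathcomp Require Import all_classical all_reals all_analysis.

Set Implicit Arguments.
Unset Strict Implicit.
Unset Printing Implicit Defensive.
Import Order.TTheory GRing.Theory Num.Theory.
Local Open Scope ring_scope.

Record sgraph (n : nat) := SGraph {
  adj :> rel 'I_n;
  adj_sym : symmetric adj;
  adj_irr : irreflexive adj
}.

Section Graph.
Variables (R : realType) (n : nat) (G : sgraph n).

Definition edges : {set {set 'I_n}} :=
  [set [set p.1; p.2] | p : 'I_n * 'I_n & G p.1 p.2].

Definition connected_graph : Prop := forall x y : 'I_n, connect G x y.

Definition degree (i : 'I_n) : nat := #|[set j | G i j]|.

Definition adjmx : 'M[R]_n := \matrix_(i, j) (G i j)%:R.

Definition deg_inv : 'M[R]_n := diag_mx (\row_i (degree i)%:R^-1).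

Definition deg_inv_sqrt : 'M[R]_n :=
  diag_mx (\row_i (Num.sqrt (degree i)%:R)^-1).

Definition normalized_laplacian : 'M[R]_n :=
  1%:M - deg_inv_sqrt *m adjmx *m deg_inv_sqrt.

Definition transition : 'M[R]_n := deg_inv *m adjmx.

End Graph.

Section Spectrum.
Variables (R : realType) (n : nat).

(* Eigenvalues with algebraic multiplicity, largest first: the mathematical
   lambda_j (1 <= j <= n) is s`_(j - 1). *)
Definition ordered_eigenvalues (A : 'M[R]_n) (s : n.-tuple R) : Prop :=
  sorted >=%R s /\ char_poly A = \prod_(x <- s) ('X - x%:P).

End Spectrum.

Section MarkovChain.
Variables (R : realType) (n : nat) (P : 'M[R]_n).

Definition stationary (pi : 'rV[R]_n) : Prop :=
  [/\ forall i, 0 <= pi 0 i, \sum_i pi 0 i = 1 & pi *m P = pi].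

(* Probability that (X_1, ..., X_k) = w for the chain started at X_0 = j. *)
Definition path_prob (j : 'I_n) (k : nat) (w : k.-tuple 'I_n) : R :=
  \prod_(t < k) P (nth j (j :: w) t) (nth j (j :: w) t.+1).

(* Probability that min {t >= 1 | X_t = i} = k given X_0 = j; as w lists
   X_1, ..., X_k, the condition says that i occurs in w for the first time
   at the last position (so the value is 0 for k = 0). *)
Definition first_passage_prob (j i : 'I_n) (k : nat) : R :=
  \sum_(w : k.-tuple 'I_n | (index i w).+1 == k) path_prob j w.

(* Expectation of the passage time in the extended reals. The event that i is
   never reached does not contribute; it is null when P is irreducible.
   For j = i this is the mean first return time. *)
Definition mean_first_passage (j i : 'I_n) : \bar R :=
  (\sum_(0 <= k <oo) (k%:R * first_passage_prob j i k)%:E)%E.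

Definition kemeny (pi : 'rV[R]_n) (j : 'I_n) : \bar R :=
  ((\sum_(i < n) (pi 0 i)%:E * mean_first_passage j i) - 1)%E.

End MarkovChain.

(* Main.v *)
(* With g = f D^{-1/2}, the Rayleigh quotient of the normalized Laplacian is
   Q(g) = sum_{ab edge} (g_a - g_b)^2 / sum_a d_a g_a^2.  Deleting r edges keeps
   the numerator and lowers the denominator on the codimension r space where
   g_a = g_b across every deleted edge, and does the same to 2 - Q where
   g_a = - g_b.  Counting dimensions as in Courant-Fischer gives
   mu_{j+r} <= theta_j and theta_{j+r} <= mu_j.  Both bounds follow by comparing
   K(G) = sum_{j < n} 1 / mu_j term by term.

   For that formula, let W be the pseudo-inverse of the Laplacian conjugated by
   D^{1/2}, so that (I - P) W = I - 1 pi, W 1 = 0 and tr W = sum 1 / mu_j.  Then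
   m_{ji} = (W_ii - W_ji + delta_ij) / pi_i solves the one-step equations, whose
   solution is automatically positive and bounds the tail of the passage time
   geometrically; hence it is the mean first passage time. *)

Require Import Defs.
From mathcomp Require Import all_boot all_order all_algebra.
From mathcomp Require Import all_classical all_reals all_analysis.
From mathcomp Require Import zify ring lra.

Set Implicit Arguments.
Unset Strict Implicit.
Unset Printing Implicit Defensive.
Import Order.TTheory GRing.Theory Num.Theory.
Local Open Scope ring_scope.

(** * Orthogonal diagonalization of real symmetric matrices *)

Lemma mx11_eqP (T : Type) (A B : 'M[T]_1) : A 0 0 = B 0 0 -> A = B.
Proof. by move=> AB; apply/matrixP => i j; rewrite !ord1. Qed.

Lemma mul_row_trE (K : pzSemiRingType) n (u v : 'rV[K]_n) :
  (u *m v^T) 0 0 = \sum_i u 0 i * v 0 i.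
Proof. by rewrite !mxE; apply: eq_bigr => i _; rewrite mxE. Qed.

Lemma mul_row_tr_ge0 (K : realDomainType) n (v : 'rV[K]_n) :
  0 <= (v *m v^T) 0 0.
Proof.
by rewrite mul_row_trE sumr_ge0// => i _; rewrite -expr2 sqr_ge0.
Qed.

Lemma mul_row_tr_eq0 (K : realDomainType) n (v : 'rV[K]_n) :
  ((v *m v^T) 0 0 == 0) = (v == 0).
Proof.
rewrite mul_row_trE psumr_eq0; last by move=> i _; rewrite -expr2 sqr_ge0.
apply/allP/eqP => [v0 |-> i _]; last by rewrite mxE mul0r eqxx.
apply/rowP => i; have := v0 i (mem_index_enum i).
by rewrite /= mulf_eq0 orbb mxE => /eqP.
Qed.

(* Q is the Householder reflection exchanging e_0 and v. *)
Lemma orthogonal_first_row (K : realFieldType) n (v : 'rV[K]_n.+1) :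
  v *m v^T = 1%:M ->
  exists2 Q : 'M[K]_n.+1, Q *m Q^T = 1%:M & row 0 Q = v.
Proof.
move=> vv; set e : 'rV[K]_n.+1 := delta_mx 0 0; set w := e - v.
have ee : e *m e^T = 1%:M.
  by rewrite /e trmx_delta mul_delta_mx; apply: mx11_eqP; rewrite !mxE.
have [w0|w0] := eqVneq w 0.
  exists 1%:M; first by rewrite trmx1 mulmx1.
  by rewrite row1; apply/eqP; rewrite -subr_eq0; apply/eqP.
pose c : K := (w *m w^T) 0 0.
have c0 : c != 0 by rewrite mul_row_tr_eq0.
have wwE : w *m w^T = c%:M by rewrite [LHS]mx11_scalar.
(* Since [e] and [v] are unit vectors, |w|^2 = 2 - 2 e.v = 2 e.w. *)
have ewE : e *m w^T = (c / 2)%:M.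
  have ve : v *m e^T = (e *m v^T)^T by rewrite trmx_mul trmxK.
  move: wwE; rewrite /w raddfB /= mulmxBl !mulmxBr ee vv ve => H.
  apply: mx11_eqP; move/matrixP/(_ 0 0): H; rewrite !mxE /= => H.
  by rewrite mulr1n -[c]mulr1n -H; field.
have wv : e - w = v by rewrite subKr.
clearbody w; exists (1%:M - (2 / c) *: (w^T *m w)).
  have -> : (1%:M - (2 / c) *: (w^T *m w))^T = 1%:M - (2 / c) *: (w^T *m w).
    by rewrite [LHS]linearB /= linearZ /= trmx1 trmx_mul trmxK.
  rewrite mulmxBl !mulmxBr !mul1mx mulmx1 -scalemxAl -!scalemxAr.
  rewrite mulmxA -[_ *m w *m _]mulmxA wwE mul_mx_scalar -!scalemxAl !scalerA.
  rewrite -scalerBl -addrA -opprD -scalerDl.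
  have -> : 2 / c + (2 / c - 2 / c * (2 / c * c)) = 0 by field.
  by rewrite scale0r subr0.
rewrite rowE -/e mulmxBr mulmx1 -scalemxAr mulmxA ewE mul_scalar_mx scalerA.
have -> : 2 / c * (c / 2) = 1 by field.
by rewrite scale1r.
Qed.

Lemma char_poly_conj_orthogonal (K : comNzRingType) n (A Q : 'M[K]_n) :
  Q *m Q^T = 1%:M -> char_poly (Q *m A *m Q^T) = char_poly A.
Proof.
move=> QQ; rewrite /char_poly /char_poly_mx.
have qq : map_mx (@polyC K) Q *m map_mx (@polyC K) Q^T = 1%:M.
  by rewrite -map_mxM QQ map_mx1.
have -> : 'X%:M - map_mx (@polyC K) (Q *m A *m Q^T) =
    map_mx (@polyC K) Q *m ('X%:M - map_mx (@polyC K) A)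
      *m map_mx (@polyC K) Q^T.
  rewrite mulmxBr mulmxBl !map_mxM; congr (_ - _).
  by rewrite mul_mx_scalar -scalemxAl qq scalemx1.
rewrite !det_mulmx mulrC mulrA.
by rewrite (mulrC (\det (map_mx _ Q^T))) -det_mulmx qq det1 mul1r.
Qed.

(** Induction on [n]: the splitting of the characteristic polynomial supplies the real eigenvalue
    [x]. Conjugating by an orthogonal matrix whose first row is a unit eigenvector leaves, by
    symmetry, a block diagonal matrix. Prescribing [s] fixes the order of the diagonal. *)
Lemma spectral_symmetric (K : rcfType) n (A : 'M[K]_n) (s : seq K) :
  A^T = A -> char_poly A = \prod_(x <- s) ('X - x%:P) ->
  exists2 U : 'M[K]_n, U *m U^T = 1%:M &
    A = U^T *m diag_mx (\row_i s`_i) *m U.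
Proof.
elim: n A s => [|n IHn] A s AT charA.
  by exists 1%:M; [apply/matrixP => -[]|apply/matrixP => -[]].
case: s charA => [|x s] charA.
  by have := size_char_poly A; rewrite charA big_nil size_poly1.
have /eigenvalueP [v vA v0] : eigenvalue A x.
  by rewrite eigenvalue_root_char charA root_prod_XsubC mem_head.
pose a : K := (v *m v^T) 0 0.
have a_gt0 : 0 < a by rewrite lt_def mul_row_tr_eq0 v0 mul_row_tr_ge0.
pose v' := (Num.sqrt a)^-1 *: v.
have v'v' : v' *m v'^T = 1%:M.
  rewrite /v' linearZ /= -scalemxAl -scalemxAr scalerA [v *m _]mx11_scalar -/a.
  rewrite scale_scalar_mx; congr (_%:M).
  by rewrite -invfM -expr2 sqr_sqrtr ?ltW// mulVf ?gt_eqF.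
have v'A : v' *m A = x *: v' by rewrite -scalemxAl vA scalerA mulrC -scalerA.
have [Q QQ Q0] := orthogonal_first_row v'v'.
(* The size is written [1 + n] so that the block operations apply. *)
pose B : 'M[K]_(1 + n) := Q *m A *m Q^T.
have BT : B^T = B by rewrite /B !trmx_mul trmxK AT mulmxA.
have B0 : row 0 B = x *: delta_mx 0 0.
  by rewrite /B !row_mul Q0 v'A -scalemxAl -Q0 -row_mul QQ row1.
have AE : A = Q^T *m B *m Q.
  by rewrite /B !mulmxA (mulmx1C QQ) mul1mx -mulmxA (mulmx1C QQ) mulmx1.
have charB : char_poly B = char_poly A by exact: char_poly_conj_orthogonal.
clearbody B; have Bul : ulsubmx B = x%:M.
  apply: mx11_eqP; rewrite !mxE eqxx mulr1n.
  have := congr1 (fun M : 'rV_n.+1 => M 0 0) B0; rewrite !mxE eqxx mulr1 => <-.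
  by congr (B _ _); apply/val_inj.
have Bur : ursubmx B = 0.
  apply/matrixP => i j; rewrite !mxE ord1.
  have := congr1 (fun M : 'rV_n.+1 => M 0 (rshift 1 j)) B0.
  rewrite !mxE /= mulr0 => <-; congr (B _ _); exact/val_inj.
have Bdl : dlsubmx B = 0 by rewrite -BT -trmx_ursub Bur trmx0.
pose B' := drsubmx B.
have BE : B = block_mx x%:M 0 0 B' by rewrite -[LHS]submxK Bul Bur Bdl.
have B'T : B'^T = B' by rewrite /B' trmx_drsub BT.
have charB' : char_poly B' = \prod_(y <- s) ('X - y%:P).
  have : char_poly B = ('X - x%:P) * char_poly B'.
    rewrite /char_poly /char_poly_mx BE map_block_mx.
    rewrite (@scalar_mx_block _ 1 n 'X).
    rewrite opp_block_mx add_block_mx !map_mx0 !oppr0 !addr0 det_lblock.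
    by rewrite map_scalar_mx -raddfB det_scalar1.
  rewrite charB charA big_cons.
  by move/(mulfI (negbT (polyXsubC_eq0 x))).
have [U' U'U' B'E] := IHn _ _ B'T charB'.
pose V : 'M[K]_n.+1 := block_mx (1%:M : 'M[K]_1) 0 0 U'.
have VT : V^T = block_mx (1%:M : 'M[K]_1) 0 0 U'^T.
  by rewrite (@tr_block_mx _ 1 n 1 n) !trmx0 trmx1.
have VV : V *m V^T = 1%:M.
  rewrite VT (@mulmx_block _ 1 n 1 n 1 n).
  rewrite !mulmx0 !mul0mx !addr0 !add0r mulmx1 U'U'.
  by rewrite -(@scalar_mx_block _ 1 n).
have DE : diag_mx (\row_i (x :: s)`_i) =
    block_mx (x%:M : 'M[K]_1) 0 0 (diag_mx (\row_i s`_i)) :> 'M[K]_(1 + n).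
  apply/matrixP => i j; rewrite !mxE.
  by case: (@splitP 1 n i) => i' iE; rewrite mxE;
    case: (@splitP 1 n j) => j' jE;
    rewrite -val_eqE /= iE jE ?add1n ?ord1 ?mxE //=.
have VDV : V^T *m diag_mx (\row_i (x :: s)`_i) *m V = B.
  rewrite VT DE !(@mulmx_block _ 1 n 1 n 1 n).
  rewrite !mulmx0 !mul0mx !addr0 !add0r.
  by rewrite !mul0mx mulmx1 mul1mx -B'E BE.
exists (V *m Q); last by rewrite AE -VDV trmx_mul !mulmxA.
by rewrite trmx_mul mulmxA -[_ *m Q *m _]mulmxA QQ mulmx1.
Qed.

(** * Mean first passage times *)

Section HittingTimes.
Import numFieldNormedType.Exports.
Local Open Scope classical_set_scope.
Local Open Scope ring_scope.
Variables (R : realType) (n : nat) (P : 'M[R]_n).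

Lemma path_prob_cons (j x : 'I_n) k (w : k.-tuple 'I_n) :
  path_prob P j (cons_tuple x w) = P j x * path_prob P x w.
Proof.
rewrite /path_prob big_ord_recl /=; congr (_ * _).
(* The two sides take different starting states as default of [nth]; every index is in range. *)
apply: eq_bigr => t _; congr (P _ _); apply: set_nth_default => /=.
  by rewrite add0n size_tuple ltnS ltnW.
by rewrite add0n size_tuple.
Qed.

Lemma sum_tuple_cons k (F : k.+1.-tuple 'I_n -> R)
    (p : pred (k.+1.-tuple 'I_n)) :
  \sum_(w | p w) F w =
  \sum_x \sum_(w : k.-tuple 'I_n | p (cons_tuple x w)) F (cons_tuple x w).
Proof.
rewrite pair_big_dep/=.
rewrite (reindex (fun u : 'I_n * k.-tuple 'I_n => cons_tuple u.1 u.2)) //=.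
exists (fun w => (thead w, [tuple of behead w])) => [[x w] _|w _] /=.
  by congr (_, _); apply/val_inj.
by rewrite [RHS]tuple_eta; apply/val_inj.
Qed.

Lemma first_passage_prob0 j i : first_passage_prob P j i 0 = 0.
Proof. by rewrite /first_passage_prob big1. Qed.

(** Conditioning on the first step: a step to [i] ends the passage, so no further step may remain;
    from any other [x] the passage starts afresh. *)
Lemma first_passage_probS j i k :
  first_passage_prob P j i k.+1 =
  \sum_x P j x * (if x == i then (k == 0)%:R else first_passage_prob P x i k).
Proof.
rewrite /first_passage_prob sum_tuple_cons; apply: eq_bigr => x _.
under eq_bigr do rewrite path_prob_cons.
rewrite -mulr_sumr; congr (_ * _) => /=.
case: (x == i); last by apply: eq_bigl => w; rewrite eqSS.
case: k => [|k] /=; last by rewrite big_pred0.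
rewrite (big_pred1 [tuple]); last by move=> w; apply/esym/eqP; exact: tuple0.
by rewrite /path_prob big_ord0.
Qed.

Hypothesis P_ge0 : forall j x, 0 <= P j x.
Hypothesis P_sum1 : forall j, \sum_x P j x = 1.
Variables (i : 'I_n) (h : 'I_n -> R).
Hypothesis hE : forall j, h j = 1 + \sum_(x | x != i) P j x * h x.

Lemma sum_taboo_le1 j : \sum_(x | x != i) P j x <= 1.
Proof.
by rewrite -(P_sum1 j) [leRHS](bigID (fun x => x != i)) /= lerDl sumr_ge0.
Qed.

(* At a minimum point m of h, h m <= 0 would give h m >= 1 + h m. *)
Lemma hitting_gt0 j : 0 < h j.
Proof.
case: (@arg_minP _ _ _ j xpredT h isT) => m _ hm.
apply: lt_le_trans (hm j isT); rewrite ltNge; apply/negP => hm0.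
have : 1 + h m <= h m.
  rewrite [leRHS]hE lerD2l.
  apply: (@le_trans _ _ (\sum_(x | x != i) P m x * h m)); last first.
    by apply: ler_sum => x _; rewrite ler_wpM2l// hm.
  by rewrite -mulr_suml ler_niMl// sum_taboo_le1.
by rewrite gerDr ler10.
Qed.

Lemma hitting_ge1 j : 1 <= h j.
Proof.
rewrite hE lerDl sumr_ge0// => x _; rewrite mulr_ge0//; exact/ltW/hitting_gt0.
Qed.

(* With T the passage time from x to i, F N x = P(T <= N) and
   X N x = E[T; T <= N]. *)
Let F N x := \sum_(0 <= k < N.+1) first_passage_prob P x i k.
Let X N x := \sum_(0 <= k < N.+1) k%:R * first_passage_prob P x i k.

(** To avoid [i] up to time N + 1, the chain has to step to some [x != i] and avoid [i] for N more
    steps. *)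
Let FS N j : 1 - F N.+1 j = \sum_(x | x != i) P j x * (1 - F N x).
Proof.
rewrite /F big_nat_recl// first_passage_prob0 add0r.
under eq_bigr do rewrite first_passage_probS.
rewrite exchange_big /= -[X in X - _](P_sum1 j) -sumrB.
rewrite (bigID (fun x => x != i)) /= [X in _ + X]big1 ?addr0.
  apply: eq_bigr => x /negbTE xi; rewrite mulrBr mulr1 mulr_sumr.
  by under eq_bigr do rewrite xi.
move=> x; rewrite negbK => /eqP ->; rewrite eqxx -mulr_sumr big_nat_recl//=.
by rewrite big1// addr0 mulr1 subrr.
Qed.

(** The tail of [F] enters because the passage time exceeds by one the passage time from the first
    state visited. *)
Let XS N j :
  h j - X N.+1 j = \sum_(x | x != i) P j x * ((h x - X N x) + (1 - F N x)).
Proof.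
rewrite /X big_nat_recl// mul0r add0r.
have -> : \sum_(0 <= k < N.+1) k.+1%:R * first_passage_prob P j i k.+1 =
    \sum_x P j x * \sum_(0 <= k < N.+1) k.+1%:R *
      (if x == i then (k == 0)%:R else first_passage_prob P x i k).
  under eq_bigr do rewrite first_passage_probS mulr_sumr.
  rewrite exchange_big /=; apply: eq_bigr => x _; rewrite mulr_sumr.
  by apply: eq_bigr => k _; rewrite mulrCA.
rewrite hE -[X in X + _ - _](P_sum1 j) addrAC -sumrB.
rewrite (bigID (fun x => x != i)) /= [X in _ + X + _]big1 ?addr0.
  rewrite -big_split /=; apply: eq_bigr => x /negbTE xi; rewrite xi.
  under eq_bigr do rewrite -natr1 mulrDl mul1r.
  by rewrite big_split /= -/(F N x); ring.
move=> x; rewrite negbK => /eqP ->; rewrite eqxx big_nat_recl//=.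
by rewrite big1 ?addr0 ?mulr1 ?subrr// => k _; rewrite mulr0.
Qed.

(** A single induction on N gives both bounds, as the remainder of [X] at [N.+1] involves the tail
    of [F] at [N]; [h] serves as weight. *)
Let FX_bound : exists2 q : R, 0 < q < 1 & exists2 C : R, 0 < C &
  forall N x, 0 <= 1 - F N x <= q ^+ N * h x
           /\ 0 <= h x - X N x <= C * q ^+ N * h x.
Proof.
(* Any positive [c] with [c * h x <= 1] for all [x] would do. *)
pose c := (\sum_x h x)^-1.
have hs_gt0 : 0 < \sum_x h x.
  rewrite (bigD1 i)//= ltr_pwDl ?hitting_gt0// sumr_ge0// => x _.
  exact/ltW/hitting_gt0.
have c_gt0 : 0 < c by rewrite invr_gt0.
have hc x : h x * c <= 1.
  rewrite ler_pdivrMr// mul1r (bigD1 x)//= lerDl sumr_ge0// => y _.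
  exact/ltW/hitting_gt0.
have c_le1 : c <= 1.
  by apply: le_trans (hc i); rewrite ler_peMl ?hitting_ge1 ?ltW//.
(* [c h <= 1] makes h a strict supersolution of the taboo chain; the ratio
   1 - c / 2 > 1 - c leaves room for the linear factor in the bound on X. *)
have Qh x : \sum_(y | y != i) P x y * h y <= (1 - c) * h x.
  have := hc x; have := hE x; lra.
exists (1 - c / 2); first by lra.
(* With q = 1 - c/2, the induction needs (C + 1)(1 - c) <= C q, that is C >= 2(1 - c)/c, and its
   base needs C >= 1. *)
exists (2 / c); first by rewrite divr_gt0.
have q0 N : 0 <= (1 - c / 2) ^+ N by apply: exprn_ge0; lra.
elim=> [|N IHN] x.
  rewrite /F /X !big_nat1 first_passage_prob0 mul0r !subr0 expr0 mul1r mulr1.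
  split; first by rewrite ler01 hitting_ge1.
  apply/andP; split; first exact/ltW/hitting_gt0.
  rewrite ler_peMl//; first exact/ltW/hitting_gt0.
  by rewrite ler_pdivlMr// mul1r; lra.
have h0 := hitting_gt0 x.
rewrite FS XS; split; apply/andP; split.
- by apply: sumr_ge0 => y _; rewrite mulr_ge0//; have [/andP[]] := IHN y.
- apply: (@le_trans _ _ ((1 - c / 2) ^+ N * ((1 - c) * h x))); last first.
    by rewrite exprSr -mulrA ler_wpM2l// ler_wpM2r ?ltW//; lra.
  apply: (@le_trans _ _ ((1 - c / 2) ^+ N * \sum_(y | y != i) P x y * h y)).
    rewrite mulr_sumr ler_sum// => y _; rewrite mulrCA ler_wpM2l//.
    by have [/andP[]] := IHN y.
  by rewrite ler_wpM2l.
- apply: sumr_ge0 => y _; rewrite mulr_ge0//.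
  by have [/andP[? _] /andP[? _]] := IHN y; rewrite addr_ge0.
- set p := (1 - c / 2) ^+ N.
  apply: (@le_trans _ _ ((2 / c + 1) * p * ((1 - c) * h x))); last first.
    rewrite exprSr -/p; set k := 2 / c.
    have kc : k * c = 2 by rewrite /k divfK ?gt_eqF.
    have -> : (k + 1) * p * ((1 - c) * h x) = ((k + 1) * (1 - c)) * (p * h x).
      by ring.
    have -> : k * (p * (1 - c / 2)) * h x = (k * (1 - c / 2)) * (p * h x).
      by ring.
    by apply: ler_wpM2r; [exact: mulr_ge0 (q0 N) (ltW h0)|lra].
  apply: (@le_trans _ _ ((2 / c + 1) * p * \sum_(y | y != i) P x y * h y)).
    rewrite mulr_sumr ler_sum// => y _; rewrite mulrCA ler_wpM2l//.
    have [/andP[_ ?] /andP[_ ?]] := IHN y.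
    rewrite (_ : _ * h y = 2 / c * p * h y + p * h y); last by ring.
    exact: lerD.
  apply: ler_wpM2l (Qh x); apply: mulr_ge0 (q0 N).
  by rewrite addr_ge0// divr_ge0// ltW.
Qed.

(** By [FX_bound] the partial sums [X N j] are within a geometric error of [h j]. *)
Lemma mean_first_passage_fixpoint j : mean_first_passage P j i = (h j)%:E.
Proof.
have [q /andP[q0 q1] [C C0 FXb]] := FX_bound.
rewrite /mean_first_passage; apply/cvg_lim => //.
(* [X N] has [N.+1] terms, hence the shift. *)
rewrite -(cvg_shiftS (fun N => (\sum_(0 <= k < N) _)%E)) /=.
under eq_fun do rewrite sumEFin.
apply: cvg_EFin; first exact: nearW.
apply: (@squeeze_cvgr _ _ _ _ (fun N => h j - C * h j * q ^+ N) (fun=> h j)).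
- apply: nearW => N; have [_] := FXb N j; rewrite /X mulrAC => /andP[? ?] /=.
  by apply/andP; split; lra.
- rewrite -[X in _ --> X]subr0 -(mulr0 (C * h j)).
  apply: cvgB; first exact: cvg_cst.
  apply: cvgM; first exact: cvg_cst.
  by apply: cvg_expr; rewrite ger0_norm ?ltW.
- exact: cvg_cst.
Qed.

End HittingTimes.

(** * Quadratic forms of a graph *)

Lemma exists_common_kernel (K : fieldType) n (s : seq 'cV[K]_n) :
  (size s < n)%N ->
  exists2 g : 'rV[K]_n, g != 0 & forall c, c \in s -> (g *m c) 0 0 = 0.
Proof.
move=> sn; pose M : 'M[K]_(n, size s) := \matrix_(i, k) (s`_k) i 0.
have kM : kermx M != 0.
  rewrite kermx_eq0 /row_free neq_ltn; apply/orP; left.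
  exact: leq_ltn_trans (rank_leq_col M) sn.
exists (nz_row (kermx M)); first by rewrite nz_row_eq0.
move=> c cs; have /sub_kermxP := nz_row_sub (kermx M).
have ci : (index c s < size s)%N by rewrite index_mem.
move/rowP/(_ (Ordinal ci)); rewrite !mxE => {2}<-.
by apply: eq_bigr => i _; rewrite !mxE nth_index.
Qed.

Section GraphForms.
Variables (R : realType) (n : nat).
Implicit Types (G H : sgraph n) (g : 'rV[R]_n).

Definition degree_form G g : R := \sum_i (degree G i)%:R * g 0 i ^+ 2.

(* Each edge is counted twice, once in each direction. *)
Definition energy (e : R) G g : R :=
  \sum_i \sum_j (G i j)%:R * (g 0 i - e * g 0 j) ^+ 2.

Definition sqrt_degree G : 'M[R]_n :=
  diag_mx (\row_i Num.sqrt (degree G i)%:R).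

Lemma degreeE G i : (degree G i)%:R = \sum_j (G i j)%:R :> R.
Proof.
rewrite /degree -sum1dep_card natr_sum big_mkcond /=.
by apply: eq_bigr => j _; case: (G i j).
Qed.

Lemma energy_ge0 e G g : 0 <= energy e G g.
Proof.
by do 2![rewrite sumr_ge0// => ? _]; rewrite mulr_ge0// sqr_ge0.
Qed.

(** Parallelogram identity on each edge. As [energy 1] is twice the numerator of Q, [energy (-1)] is
    twice that of 2 - Q. *)
Lemma energy_add G g : energy 1 G g + energy (-1) G g = 4 * degree_form G g.
Proof.
have sqE : \sum_i \sum_j (G i j)%:R * g 0 i ^+ 2 = degree_form G g.
  by apply: eq_bigr => i _; rewrite -mulr_suml -degreeE.
have sqE' : \sum_i \sum_j (G i j)%:R * g 0 j ^+ 2 = degree_form G g.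
  rewrite exchange_big /= -sqE; apply: eq_bigr => i _; apply: eq_bigr => j _.
  by rewrite adj_sym.
transitivity (2 * (degree_form G g + degree_form G g)); last by ring.
rewrite -{1}sqE -sqE' -!big_split mulr_sumr; apply: eq_bigr => i _ /=.
rewrite -!big_split mulr_sumr; apply: eq_bigr => j _ /=; ring.
Qed.

Lemma sqrt_degreeK G : (forall i, (0 < degree G i)%N) ->
  sqrt_degree G *m deg_inv_sqrt R G = 1%:M.
Proof.
move=> d0; rewrite /sqrt_degree /deg_inv_sqrt mulmx_diag -diag_const_mx.
congr diag_mx; apply/rowP => i; rewrite !mxE mulfV// gt_eqF// sqrtr_gt0.
by rewrite ltr0n.
Qed.

Lemma tr_sqrt_degree G : (sqrt_degree G)^T = sqrt_degree G.
Proof. exact: tr_diag_mx. Qed.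

Lemma degree_formE G g :
  degree_form G g = ((g *m sqrt_degree G) *m (g *m sqrt_degree G)^T) 0 0.
Proof.
rewrite mul_row_trE; apply: eq_bigr => i _.
by rewrite mul_mx_diag !mxE mulrACA -!expr2 sqr_sqrtr// mulrC.
Qed.

Lemma energyE G g : (forall i, (0 < degree G i)%N) ->
  energy 1 G g = 2 * ((g *m sqrt_degree G) *m normalized_laplacian R G
                        *m (g *m sqrt_degree G)^T) 0 0.
Proof.
move=> d0; have dK := sqrt_degreeK d0.
have dK' : deg_inv_sqrt R G *m sqrt_degree G = 1%:M by rewrite mulmx1C.
rewrite /normalized_laplacian mulmxBr mulmxBl mulmx1 [in RHS]mxE -degree_formE.
rewrite trmx_mul tr_sqrt_degree !mulmxA -(mulmxA g) dK mulmx1.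
rewrite -[_ *m _ *m sqrt_degree G]mulmxA dK' mulmx1 !mxE.
have AE : \sum_j (g *m adjmx R G) 0 j * g^T j 0 =
    \sum_i \sum_j (G i j)%:R * (g 0 i * g 0 j).
  rewrite exchange_big; apply: eq_bigr => j _ /=.
  rewrite !mxE mulr_suml; apply: eq_bigr => i _; rewrite !mxE; ring.
rewrite AE.
(* The difference of the two energies isolates the cross terms, their sum the squares. *)
have := energy_add G g; suff : energy (-1) G g - energy 1 G g =
   4 * \sum_i \sum_j (G i j)%:R * (g 0 i * g 0 j) by lra.
rewrite /energy -sumrB mulr_sumr; apply: eq_bigr => i _.
rewrite -sumrB mulr_sumr; apply: eq_bigr => j _; ring.
Qed.

(** * Rayleigh quotients in an orthonormal eigenbasis *)

Section Diagonalized.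
Variables (G : sgraph n) (U : 'M[R]_n) (mu : n.-tuple R).
Hypothesis d0 : forall i, (0 < degree G i)%N.
Hypothesis UU : U *m U^T = 1%:M.
Hypothesis LE : normalized_laplacian R G = U^T *m diag_mx (\row_i mu`_i) *m U.

(** The rows of [U] are the eigenvectors, and f = g D^{1/2} is expanded in them. A single matrix
    acting on [g] matches the conditions of [exists_test_vector]. *)
Definition eigen_coord g := g *m (sqrt_degree G *m U^T).

Lemma degree_form_coord g :
  degree_form G g = \sum_i eigen_coord g 0 i ^+ 2.
Proof.
rewrite degree_formE.
have -> : (g *m sqrt_degree G) *m (g *m sqrt_degree G)^T =
    eigen_coord g *m (eigen_coord g)^T.
  rewrite /eigen_coord !trmx_mul !trmxK !mulmxA -[_ *m U^T *m U]mulmxA.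
  by rewrite (mulmx1C UU) mulmx1.
by rewrite mul_row_trE; under eq_bigr do rewrite -expr2.
Qed.

Lemma energy_coord g :
  energy 1 G g = 2 * \sum_(i < n) mu`_i * eigen_coord g 0 i ^+ 2.
Proof.
rewrite energyE// LE; congr (_ * _).
have -> : g *m sqrt_degree G *m (U^T *m diag_mx (\row_i mu`_i) *m U) *m
   (g *m sqrt_degree G)^T =
   eigen_coord g *m diag_mx (\row_i mu`_i) *m (eigen_coord g)^T.
  by rewrite /eigen_coord !trmx_mul !trmxK !mulmxA.
rewrite mul_row_trE; apply: eq_bigr => i _.
by rewrite mul_mx_diag !mxE; ring.
Qed.

Hypothesis mu_sorted : sorted >=%R mu.

Lemma mu_anti (i j : nat) : (i <= j)%N -> (j < n)%N -> mu`_j <= mu`_i.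
Proof.
move=> ij jn.
apply: (@sorted_leq_nth _ >=%R _ _ 0 mu mu_sorted _ _ _ _ ij) => //.
- by move=> x y z /= xy yz; apply: le_trans yz xy.
- by move=> x /=.
- by rewrite inE size_tuple (leq_ltn_trans ij).
- by rewrite inE size_tuple.
Qed.

(** One half of Courant-Fischer: the eigenvalues decrease, so those with index at most [k] are at
    least the one at [k]. The factor 2 is the double count in [energy]. *)
Lemma energy_ge_coord (k : nat) g :
  (k < n)%N -> (forall i : 'I_n, (k < i)%N -> eigen_coord g 0 i = 0) ->
  2 * mu`_k * degree_form G g <= energy 1 G g.
Proof.
move=> kn gk; rewrite energy_coord degree_form_coord -mulrA ler_pM2l//.
rewrite mulr_sumr ler_sum// => i _; have [ik|ki] := leqP i k.
  by rewrite ler_wpM2r ?sqr_ge0// mu_anti.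
by rewrite gk// expr0n !mulr0.
Qed.

Lemma energy_le_coord (k : nat) g :
  (k < n)%N -> (forall i : 'I_n, (i < k)%N -> eigen_coord g 0 i = 0) ->
  energy 1 G g <= 2 * mu`_k * degree_form G g.
Proof.
move=> kn gk; rewrite energy_coord degree_form_coord -mulrA ler_pM2l//.
rewrite mulr_sumr ler_sum// => i _; have [ki|ik] := leqP k i.
  by rewrite ler_wpM2r ?sqr_ge0// mu_anti.
by rewrite gk// expr0n !mulr0.
Qed.

End Diagonalized.

Lemma degree_form_gt0 G g :
  (forall i, (0 < degree G i)%N) -> g != 0 -> 0 < degree_form G g.
Proof.
move=> d0 g0; rewrite lt_def sumr_ge0 ?andbT => [|i _]; last first.
  by rewrite mulr_ge0 ?sqr_ge0.
apply: contra g0; rewrite psumr_eq0 => [/allP H|i _]; last first.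
  by rewrite mulr_ge0 ?sqr_ge0.
apply/eqP/rowP => i; have := H i (mem_index_enum i).
by rewrite mulf_eq0 pnatr_eq0 gtn_eqF//= sqrf_eq0 mxE => /eqP.
Qed.

(** Every square in the energy vanishes, so [g] agrees across edges and hence along paths. *)
Lemma eq_of_energy0 G g : connected_graph G -> energy 1 G g = 0 ->
  forall x y, g 0 x = g 0 y.
Proof.
move=> cG /eqP; rewrite psumr_eq0 => [/allP E0|i _]; last first.
  by rewrite sumr_ge0// => j _; rewrite mulr_ge0 ?sqr_ge0.
have edge x y : G x y -> g 0 x = g 0 y.
  move=> Gxy; have /= := E0 x (mem_index_enum x).
  rewrite psumr_eq0 => [/allP /(_ y (mem_index_enum y)) /=|j _]; last first.
    by rewrite mulr_ge0 ?sqr_ge0.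
  by rewrite Gxy !mul1r sqrf_eq0 subr_eq0 => /eqP.
move=> x y; have /connectP [p] := cG x y.
elim: p x => [|z p IHp] x /=; first by move=> _ ->.
by move=> /andP[/edge -> /IHp].
Qed.

Lemma degree_gt0 G : (2 <= n)%N -> connected_graph G ->
  forall i, (0 < degree G i)%N.
Proof.
move=> n2 cG x; have [y yx] : exists y, y != x.
  have : (0 < #|predC1 x|)%N by rewrite cardC1 card_ord; case: (n) n2 => [|[]].
  by move/card_gt0P => [y]; exists y.
have /connectP [[|z p] /=] := cG x y.
  by move=> _ xy; rewrite xy eqxx in yx.
by move=> /andP[xz _] _; apply/card_gt0P; exists z; rewrite inE.
Qed.

End GraphForms.

(** * Edge deletion and interlacing *)

(** An unordered pair determines its ends up to a swap, which symmetry absorbs; irreflexivity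
    excludes singletons. *)
Lemma mem_edges n (G : sgraph n) a b : ([set a; b]%SET \in edges G) = G a b.
Proof.
apply/imsetP/idP => [[[x y]]|Gab]; last by exists (a, b); rewrite ?inE.
rewrite inE /= => Gxy /setP E.
have ab : a != b.
  apply/eqP => ab; move: (E x) (E y) Gxy; rewrite ab !inE !eqxx /= !orbb orbT.
  by move=> /eqP -> /eqP ->; rewrite adj_irr.
have := E b; have := E a; rewrite !inE !eqxx /= orbT => /esym/orP[]/eqP aE;
  move/esym/orP => []/eqP bE.
- by rewrite aE bE eqxx in ab.
- by rewrite aE bE.
- by rewrite aE bE adj_sym.
- by rewrite aE bE eqxx in ab.
Qed.

Lemma size_enum_ltn n j :
  (j <= n)%N -> size [seq i : 'I_n <- enum 'I_n | (i < j)%N] = j.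
Proof.
move=> jn; rewrite size_filter.
have -> : count (fun i : 'I_n => (i < j)%N) (enum 'I_n) =
    count (fun i => (i < j)%N) (iota 0 n).
  by rewrite -val_enum_ord count_map.
by rewrite -size_filter -[j in RHS](size_iota 0) -(@filter_iota_ltn 0 n j).
Qed.

Lemma size_enum_gtn n j :
  (j < n)%N -> size [seq i : 'I_n <- enum 'I_n | (j < i)%N] = (n - j.+1)%N.
Proof.
move=> jn; have := count_predC (fun i : 'I_n => (i < j.+1)%N) (enum 'I_n).
rewrite size_enum_ord -size_filter size_enum_ltn// size_filter => nE.
rewrite -[in RHS]nE addKn; by apply: eq_count => i /=; rewrite -leqNgt.
Qed.

(* The conditions on g number (n - 1 - j - r) + j + r = n - 1. *)
Lemma exists_test_vector (K : fieldType) n (M N : 'M[K]_n)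
    (F : {set {set 'I_n}}) (e : K) (j r : nat) :
  e * e = 1 -> #|F| = r -> (j + r < n)%N ->
  exists2 g : 'rV[K]_n, g != 0 &
    [/\ forall i : 'I_n, (j + r < i)%N -> (g *m M) 0 i = 0,
        forall i : 'I_n, (i < j)%N -> (g *m N) 0 i = 0 &
        forall a b, [set a; b]%SET \in F -> g 0 a = e * g 0 b].
Proof.
move=> ee Fr jrn.
(* The linear condition attached to [E], for an arbitrary choice of orientation. *)
pose c (E : {set 'I_n}) : 'cV[K]_n :=
  if [pick p : 'I_n * 'I_n | [set p.1; p.2]%SET == E] is Some p
  then delta_mx p.1 0 - e *: delta_mx p.2 0 else 0.
pose sM :=
  [seq col i M | i : 'I_n <- [seq i : 'I_n <- enum 'I_n | (j + r < i)%N]].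
pose sN :=
  [seq col i N | i : 'I_n <- [seq i : 'I_n <- enum 'I_n | (i < j)%N]].
have [|g g0 gs] :=
  @exists_common_kernel K n (sM ++ sN ++ [seq c E | E <- enum F]).
  rewrite !size_cat !size_map -cardE Fr size_enum_ltn; last first.
    by apply: leq_trans (ltnW jrn); exact: leq_addr.
  by rewrite size_enum_gtn// subnS -subSS; lia.
have mul_colE (A : 'M[K]_n) i : (g *m col i A) 0 0 = (g *m A) 0 i.
  by rewrite !mxE; apply: eq_bigr => k _; rewrite mxE.
exists g => //; split=> [i ji|i ij|a b abF].
- rewrite -mul_colE gs// mem_cat; apply/orP; left.
  by apply: map_f; rewrite mem_filter ji mem_enum.
- rewrite -mul_colE gs// !mem_cat; apply/orP; right; apply/orP; left.
  by apply: map_f; rewrite mem_filter ij mem_enum.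
- have : (g *m c [set a; b]%SET) 0 0 = 0.
    rewrite gs// !mem_cat; apply/orP; right; apply/orP; right.
    by apply: map_f; rewrite mem_enum.
  rewrite /c; case: pickP => [[x y] /= /eqP/setP E|/(_ (a, b))]; last first.
    by rewrite /= eqxx.
  rewrite mulmxBr -scalemxAr -!colE !mxE => /subr0_eq gxy.
  (* The chosen orientation may be the opposite one; [e * e = 1] reverses the equation. *)
  have gyx : g 0 y = e * g 0 x by rewrite gxy mulrA ee mul1r.
  have := E a; have := E b; have := E x; have := E y.
  rewrite !inE !eqxx !orbT /= => /esym/orP Ey /esym/orP Ex /orP Eb /orP Ea.
  case: Ea Eb Ex Ey => /eqP -> [] /eqP -> // [] /eqP xE [] /eqP yE;
    by rewrite ?xE ?yE // in gxy gyx *.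
Qed.

Lemma adj_deletion n (G H : sgraph n) (F : {set {set 'I_n}}) a b :
  edges H = edges G :\: F -> H a b = G a b && ([set a; b]%SET \notin F).
Proof. by move=> HF; rewrite -!mem_edges HF inE andbC. Qed.

Section Deletion.
Variables (R : realType) (n : nat) (G H : sgraph n) (F : {set {set 'I_n}}).
Hypothesis HF : edges H = edges G :\: F.
Implicit Type g : 'rV[R]_n.

Lemma energy_deletion e g :
  (forall a b, [set a; b]%SET \in F -> g 0 a = e * g 0 b) ->
  energy e H g = energy e G g.
Proof.
move=> gF; apply: eq_bigr => a _; apply: eq_bigr => b _.
rewrite (adj_deletion _ _ HF); case: (boolP ([set a; b]%SET \in F)) => abF.
  by rewrite (gF _ _ abF) subrr expr0n !mulr0.
by rewrite andbT.
Qed.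

Lemma degree_form_deletion g : degree_form H g <= degree_form G g.
Proof.
apply: ler_sum => i _; rewrite ler_wpM2r ?sqr_ge0// ler_nat.
apply/subset_leq_card/fintype.subsetP => b; rewrite !inE (adj_deletion _ _ HF).
by case/andP.
Qed.

End Deletion.

Section Interlacing.
Variables (R : realType) (n : nat).
Hypothesis n2 : (2 <= n)%N.

Lemma normalized_laplacian_spectral (G : sgraph n) (mu : n.-tuple R) :
  ordered_eigenvalues (normalized_laplacian R G) mu ->
  exists2 U : 'M[R]_n, U *m U^T = 1%:M &
    normalized_laplacian R G = U^T *m diag_mx (\row_i mu`_i) *m U.
Proof.
case=> _; apply: spectral_symmetric.
rewrite /normalized_laplacian linearB /= !trmx_mul trmx1 tr_diag_mx mulmxA.
congr (_ - _ *m _ *m _).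
by apply/matrixP => i j; rewrite !mxE adj_sym.
Qed.

Variables (G H : sgraph n) (F : {set {set 'I_n}}) (mu theta : n.-tuple R).
Hypothesis cG : connected_graph G.
Hypothesis cH : connected_graph H.
Hypothesis HF : edges H = edges G :\: F.
Hypothesis muP : ordered_eigenvalues (normalized_laplacian R G) mu.
Hypothesis thetaP : ordered_eigenvalues (normalized_laplacian R H) theta.

(** With E half of [energy 1] and D the degree form, the test vector gives mu_{j+r} D_G <= E_G = E_H
    <= theta_j D_H <= theta_j D_G, with indices from 0 and r the size of [F]. *)
Lemma interlacing_lower j : (j + #|F| < n)%N -> mu`_(j + #|F|) <= theta`_j.
Proof.
move=> jn; have [U UU UE] := normalized_laplacian_spectral muP.
have [V VV VE] := normalized_laplacian_spectral thetaP.
have dG := degree_gt0 n2 cG; have dH := degree_gt0 n2 cH.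
have [g g0 [gG gH gF]] := exists_test_vector
  (sqrt_degree R G *m U^T) (sqrt_degree R H *m V^T) (mulr1 1) (erefl #|F|) jn.
have EG := energy_ge_coord dG UU UE muP.1 jn gG.
have jn' : (j < n)%N := leq_ltn_trans (leq_addr _ _) jn.
have EH := energy_le_coord dH VV VE thetaP.1 jn' gH.
rewrite (energy_deletion HF gF) in EH.
have DG := degree_form_gt0 dG g0; have DH := degree_form_gt0 dH g0.
(* This sign allows D_H to be replaced by the larger D_G. *)
have theta0 : 0 <= theta`_j.
  have := le_trans (energy_ge0 _ _ _) EH.
  by rewrite pmulr_lge0// pmulr_rge0.
have : theta`_j * degree_form H g <= theta`_j * degree_form G g.
  by rewrite ler_wpM2l// (degree_form_deletion HF).
by move=> le_th; rewrite -(ler_pM2r DG); lra.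
Qed.

(* The numerators of the quotients 2 - Q are the signless forms
   sum_{ab edge} (g_a + g_b)^2, that is, [energy (-1)]. *)
Lemma interlacing_upper j : (j + #|F| < n)%N -> theta`_(j + #|F|) <= mu`_j.
Proof.
move=> jn; have [U UU UE] := normalized_laplacian_spectral muP.
have [V VV VE] := normalized_laplacian_spectral thetaP.
have dG := degree_gt0 n2 cG; have dH := degree_gt0 n2 cH.
have ee : (-1) * (-1) = 1 :> R by rewrite mulrNN mulr1.
have [g g0 [gH gG gF]] := exists_test_vector
  (sqrt_degree R H *m V^T) (sqrt_degree R G *m U^T) ee (erefl #|F|) jn.
have EH := energy_ge_coord dH VV VE thetaP.1 jn gH.
have jn' : (j < n)%N := leq_ltn_trans (leq_addr _ _) jn.
have EG := energy_le_coord dG UU UE muP.1 jn' gG.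
have EE := energy_deletion HF gF.
have DG := degree_form_gt0 dG g0; have DH := degree_form_gt0 dH g0.
have SH := energy_add H g; have SG := energy_add G g.
have SH0 := energy_ge0 (-1) H g.
set t := theta`_(j + #|F|) in EH *; set m := mu`_j in EG *.
(* On [H], 2 - Q is nonnegative and at most 2 - t; the sign is needed to pass from D_H to D_G. *)
have t2 : 0 <= 2 - t.
  have : 0 <= 2 * (2 - t) * degree_form H g by lra.
  by rewrite pmulr_lge0// pmulr_rge0.
have : (2 - t) * degree_form H g <= (2 - t) * degree_form G g.
  by rewrite ler_wpM2l// (degree_form_deletion HF).
by move=> le_th; rewrite -(ler_pM2r DG); lra.
Qed.

End Interlacing.

(** * Kemeny's constant as a spectral sum *)

Section Spectrum.
Variables (R : realType) (n : nat) (G : sgraph n).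
Variables (U : 'M[R]_n) (mu : n.-tuple R) (l : 'I_n).
Hypothesis d0 : forall i, (0 < degree G i)%N.
Hypothesis cG : connected_graph G.
Hypothesis UU : U *m U^T = 1%:M.
Hypothesis LE : normalized_laplacian R G = U^T *m diag_mx (\row_i mu`_i) *m U.
Hypothesis mu_sorted : sorted >=%R mu.
Hypothesis lE : l.+1 = n.

Let w : 'rV[R]_n := const_mx 1.
Let coord := eigen_coord G U.
Let vec i : 'rV[R]_n := delta_mx 0 i *m U *m deg_inv_sqrt R G.

Let coord_vec i : coord (vec i) = delta_mx 0 i.
Proof.
rewrite /coord /eigen_coord /vec mulmxA -[_ *m _ *m sqrt_degree R G]mulmxA.
by rewrite (mulmx1C (sqrt_degreeK R d0)) mulmx1 -mulmxA UU mulmx1.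
Qed.

Let energy_vec i : energy 1 G (vec i) = 2 * mu`_i.
Proof.
rewrite (energy_coord d0 LE) -/coord coord_vec; congr (_ * _).
rewrite (bigD1 i)//= big1 ?addr0 ?mxE ?eqxx ?expr1n ?mulr1// => k /negbTE ki.
by rewrite mxE ki andbF expr0n mulr0.
Qed.

Lemma eigenvalue_ge0 (i : 'I_n) : 0 <= mu`_i.
Proof.
by have := energy_ge0 1 G (vec i); rewrite energy_vec pmulr_rge0.
Qed.

Let row_dot i k : (row i U *m (row k U)^T) 0 0 = (i == k)%:R.
Proof.
have /matrixP/(_ i k) := UU; rewrite !mxE => <-.
by apply: eq_bigr => x _; rewrite !mxE.
Qed.

(** Zero energy makes g = f D^{-1/2} constant by connectedness; the constant is nonzero because f is
    a unit vector. *)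
Lemma eigenvector0 (i : 'I_n) : mu`_i = 0 ->
  exists2 a : R, a != 0 & row i U = a *: (w *m sqrt_degree R G).
Proof.
move=> mui; have e0 : energy 1 G (vec i) = 0 by rewrite energy_vec mui mulr0.
have vc := eq_of_energy0 cG e0.
have rE : row i U = vec i 0 i *: (w *m sqrt_degree R G).
  rewrite scalemxAl (_ : vec i 0 i *: w = vec i); last first.
    by apply/rowP => k; rewrite [LHS]mxE [w _ _]mxE mulr1.
  by rewrite -mulmxA (mulmx1C (sqrt_degreeK R d0)) mulmx1 rowE.
exists (vec i 0 i) => //; apply/eqP => a0.
have := row_dot i i; rewrite rE a0 scale0r mul0mx mxE eqxx => /eqP.
by rewrite eq_sym oner_eq0.
Qed.

Let energy_w : energy 1 G w = 0.
Proof.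
rewrite /energy big1// => i _; rewrite big1// => k _.
by rewrite !mxE mulr1 subrr expr0n mulr0.
Qed.

(** Constants have zero energy, and [energy_ge_coord] at the last index applies to every vector. *)
Lemma eigenvalue_last : mu`_l = 0.
Proof.
apply/eqP; rewrite eq_le eigenvalue_ge0 andbT.
have w0 : w != 0.
  by apply/eqP => /rowP/(_ l)/eqP; rewrite !mxE oner_eq0.
have DF := degree_form_gt0 d0 w0.
have := energy_ge_coord d0 UU LE mu_sorted (ltn_ord l) (g := w).
rewrite energy_w pmulr_lle0// pmulr_rle0//; apply => i li.
by move: li; rewrite ltnNge -ltnS lE ltn_ord.
Qed.

(** A second zero eigenvalue would give two orthogonal rows of [U], both nonzero multiples of one
    vector. *)
Lemma eigenvalue_gt0 (i : 'I_n) : i != l -> 0 < mu`_i.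
Proof.
move=> il; rewrite lt_def eigenvalue_ge0 andbT; apply/eqP => mui.
have [a a0 rowi] := eigenvector0 mui.
have [b b0 rowl] := eigenvector0 eigenvalue_last.
have := row_dot i l; have := row_dot i i.
rewrite rowl rowi eqxx (negbTE il) !linearZ /= -!scalemxAl !mxE => E1.
move/eqP; rewrite mulf_eq0 (negbTE b0) mulf_eq0 (negbTE a0) /= => /eqP E0.
by move/eqP: E1; rewrite E0 !mulr0 eq_sym oner_eq0.
Qed.

Local Notation D := (deg_inv_sqrt R G).
Local Notation S := (sqrt_degree R G).
(* The pseudo-inverse of the Laplacian, as 0^-1 = 0, conjugated so that it acts
   on functions. *)
Let W := D *m (U^T *m diag_mx (\row_(i < n) (mu`_i)^-1) *m U) *m S.

Let DS : D *m S = 1%:M. Proof. exact: mulmx1C (sqrt_degreeK R d0). Qed.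

Lemma trace_pseudoinverse : \tr W = \sum_(0 <= k < n - 1) (mu`_k)^-1.
Proof.
rewrite /W mxtrace_mulC (mulmxA S) (sqrt_degreeK R d0) mul1mx.
rewrite mxtrace_mulC (mulmxA U) UU mul1mx mxtrace_diag.
under eq_bigr do rewrite mxE.
rewrite -(big_mkord xpredT (fun k => (mu`_k)^-1)).
have -> : (n - 1)%N = l by rewrite -[X in (X - 1)%N]lE subn1.
rewrite -[X in \sum_(0 <= i < X) _ = _]lE.
by rewrite big_nat_recr//= eigenvalue_last invr0 addr0.
Qed.

(** [S *m w^T] is a multiple of the kernel eigenvector, which the pseudo-inverse kills. *)
Lemma pseudoinverse_const : W *m w^T = 0.
Proof.
have [a a0 rowl] := eigenvector0 eigenvalue_last.
have wE : S *m w^T = a^-1 *: (row l U)^T.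
  by rewrite rowl linearZ /= scalerA mulVf// scale1r trmx_mul tr_sqrt_degree.
rewrite /W -!mulmxA wE rowE trmx_mul trmx_delta -!scalemxAr (mulmxA U) UU.
rewrite mul1mx.
rewrite (_ : diag_mx (\row_(i < n) (mu`_i)^-1) *m delta_mx l 0 = 0).
  by rewrite !mulmx0 scaler0.
apply/matrixP => i k; rewrite mul_diag_mx !mxE.
have [->|_] := eqVneq i l; first by rewrite eigenvalue_last invr0 mul0r.
by rewrite mulr0.
Qed.

(** As I - P is the Laplacian conjugated by D^{1/2}, the product is the conjugate of the projection
    off the kernel eigenvector. Its rank one part has all rows proportional to the degrees. *)
Lemma laplacian_pseudoinverse : exists a2 : R,
  a2 != 0 /\ forall i j, ((1%:M - transition R G) *m W) j i =
     (j == i)%:R - a2 * (degree G i)%:R.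
Proof.
have [a a0 rowl] := eigenvector0 eigenvalue_last.
exists (a * a); split; first by rewrite mulf_neq0.
have -> : 1%:M - transition R G = D *m normalized_laplacian R G *m S.
  rewrite /normalized_laplacian mulmxBr mulmxBl mulmx1 DS !mulmxA.
  rewrite -[_ *m D *m S]mulmxA DS mulmx1; congr (_ - _ *m _).
  rewrite /deg_inv mulmx_diag; congr diag_mx; apply/rowP => i.
  by rewrite !mxE -invfM -expr2 sqr_sqrtr.
have -> : D *m normalized_laplacian R G *m S *m W =
    1%:M - (a * a) *: (w^T *m (w *m S *m S)).
  have -> : D *m normalized_laplacian R G *m S *m W =
     D *m (U^T *m (diag_mx (\row_i mu`_i) *m
       diag_mx (\row_(i < n) (mu`_i)^-1)) *m U) *m S.
    rewrite /W LE !mulmxA -[_ *m S *m D]mulmxA (sqrt_degreeK R d0) mulmx1.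
    by rewrite -[_ *m U *m U^T]mulmxA UU mulmx1.
  have -> : diag_mx (\row_i mu`_i) *m diag_mx (\row_(i < n) (mu`_i)^-1) =
     1%:M - delta_mx l l.
    apply/matrixP => i k; rewrite mul_diag_mx !mxE.
    have [<-|ik] := eqVneq i k; last first.
      rewrite mulr0n mulr0 sub0r; case: eqVneq => [il|]; last by rewrite oppr0.
      by rewrite -il eq_sym (negbTE ik) oppr0.
    have [->|il] := eqVneq i l.
      by rewrite eigenvalue_last mul0r subrr.
    by rewrite mulr1n mulfV ?subr0// gt_eqF// eigenvalue_gt0.
  rewrite mulmxBr mulmx1 mulmxBl (mulmx1C UU) mulmxBr mulmx1 mulmxBl DS.
  congr (_ - _); rewrite -(mul_delta_mx (0 : 'I_1) l l) !mulmxA.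
  have -> : D *m U^T *m delta_mx l 0 = a *: w^T.
    rewrite -mulmxA -[delta_mx l 0]trmxK trmx_delta -trmx_mul -rowE rowl.
    rewrite linearZ /= trmx_mul tr_sqrt_degree -scalemxAr mulmxA DS.
    by rewrite mul1mx.
  rewrite -[_ *m delta_mx 0 l *m U]mulmxA -rowE rowl.
  by rewrite -!scalemxAl -scalemxAr -scalemxAl scalerA mulmxA.
move=> i j; rewrite !mxE big_ord1 -mulmxA; congr (_ - _ * _).
by rewrite mulmx_diag mul_mx_diag !mxE !mul1r -expr2 sqr_sqrtr.
Qed.

End Spectrum.

(** * From the pseudo-inverse to Kemeny's constant *)

Section Kemeny.
Variables (R : realType) (n : nat) (G : sgraph n) (mu : n.-tuple R).
Hypothesis n2 : (2 <= n)%N.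
Hypothesis cG : connected_graph G.
Hypothesis muP : ordered_eigenvalues (normalized_laplacian R G) mu.

Lemma laplacian_eigenvalue_gt0 k : (k < n - 1)%N -> 0 < mu`_k.
Proof.
move=> kn; have [U UU LE] := normalized_laplacian_spectral muP.
have ln : (n - 1 < n)%N by lia.
have kn' : (k < n)%N by lia.
have lE : (Ordinal ln).+1 = n by rewrite /=; lia.
apply: (eigenvalue_gt0 (degree_gt0 n2 cG) cG UU LE muP.1 lE (i := Ordinal kn')).
by rewrite -val_eqE /= neq_ltn kn.
Qed.

Lemma laplacian_eigenvalue_anti i j :
  (i <= j)%N -> (j < n)%N -> mu`_j <= mu`_i.
Proof. exact: mu_anti muP.1 _ _. Qed.

(** Summing pi_i m_{ji} = W_ii - W_ji + delta_ij over i gives tr W + 1, because the rows of W sum to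
    0. *)
Lemma kemenyE (pi : 'rV[R]_n) (j : 'I_n) :
  stationary (transition R G) pi ->
  kemeny (transition R G) pi j = (\sum_(0 <= k < n - 1) (mu`_k)^-1)%:E.
Proof.
case=> _ pi1 piP; have [U UU LE] := normalized_laplacian_spectral muP.
have ln : (n - 1 < n)%N by lia.
have lE : (Ordinal ln).+1 = n by rewrite /=; lia.
have d0 := degree_gt0 n2 cG.
have [a2 [a0 WE]] := laplacian_pseudoinverse d0 cG UU LE muP.1 lE.
have W1 := pseudoinverse_const d0 cG UU LE muP.1 lE.
have trW := trace_pseudoinverse d0 UU LE muP.1 lE.
(* [W] is abstracted, keeping its product with I - P, its row sums and its trace. *)
move: (_ *m _ *m sqrt_degree R G) WE W1 trW => W WE W1 trW.
(* Stationarity gives pi (I - P) W = 0, whose [i]-th entry is pi_i - a2 d_i. *)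
have piE i : pi 0 i = a2 * (degree G i)%:R.
  have : (pi *m ((1%:M - transition R G) *m W)) 0 i = 0.
    by rewrite mulmxA mulmxBr mulmx1 piP subrr mul0mx mxE.
  rewrite mxE; under eq_bigr do rewrite WE mulrBr.
  rewrite sumrB -mulr_suml pi1 mul1r (bigD1 i)//= eqxx mulr1 big1.
    by rewrite addr0 => /subr0_eq.
  by move=> k /negbTE ->; rewrite mulr0.
have pi0 i : pi 0 i != 0 by rewrite piE mulf_neq0// pnatr_eq0 gtn_eqF.
pose h i x := (W i i - W x i + (x == i)%:R) / pi 0 i.
have P_ge0 x y : 0 <= transition R G x y.
  by rewrite /transition /deg_inv mul_diag_mx !mxE mulr_ge0// invr_ge0.
have P_sum1 x : \sum_y transition R G x y = 1.
  rewrite /transition /deg_inv mul_diag_mx; under eq_bigr do rewrite !mxE.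
  by rewrite -mulr_sumr -degreeE mulVf// pnatr_eq0 gtn_eqF.
have hE i x : h i x = 1 + \sum_(y | y != i) transition R G x y * h i y.
  have WxE : W x i - \sum_y transition R G x y * W y i = (x == i)%:R - pi 0 i.
    by rewrite piE -WE mulmxBl mul1mx !mxE.
  (* The term y = i may be added, since W_ii - W_yi vanishes there. *)
  have -> : \sum_(y | y != i) transition R G x y * h i y =
      \sum_y transition R G x y * (W i i - W y i) / pi 0 i.
    rewrite [RHS](bigD1 i)//= subrr mulr0 mul0r add0r; apply: eq_bigr => y yi.
    by rewrite /h (negbTE yi) addr0 mulrA.
  rewrite -mulr_suml; under eq_bigr do rewrite mulrBr.
  rewrite sumrB -mulr_suml P_sum1 mul1r /h -[X in X + _ / _](divff (pi0 i)).
  by rewrite -mulrDl; congr (_ / _); lra.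
rewrite /kemeny; under eq_bigr do
  rewrite (mean_first_passage_fixpoint P_ge0 P_sum1 (hE _)) -EFinM.
rewrite sumEFin -EFinB; congr EFin.
under eq_bigr do rewrite /h mulrC divfK//.
rewrite big_split sumrB /= -/(\tr W) trW.
have -> : \sum_i W j i = 0.
  have /colP/(_ j) := W1; rewrite !mxE => {2}<-.
  by apply: eq_bigr => i _; rewrite !mxE mulr1.
have -> : \sum_i (j == i)%:R = 1 :> R.
  rewrite (bigD1 j)//= eqxx big1 ?addr0// => i ij.
  by rewrite eq_sym (negbTE ij).
by rewrite subr0 addrK.
Qed.

End Kemeny.

Theorem theorem5p7 (R : realType) (n r : nat) (G H : sgraph n)
    (F : {set {set 'I_n}}) (mu theta : n.-tuple R)
    (pi : 'rV[R]_n) (j0 : 'I_n)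
    (hn : (2 <= n)%N)
    (hG : connected_graph G)
    (hH : connected_graph H)
    (hF : F \subset edges G)
    (hHF : edges H = edges G :\: F)
    (hFr : #|F| = r)
    (hr : (r <= n - 1)%N)
    (hmu : ordered_eigenvalues (normalized_laplacian R G) mu)
    (htheta : ordered_eigenvalues (normalized_laplacian R H) theta)
    (hpi : stationary (transition R G) pi) :
  ((r%:R / mu`_0 + \sum_(0 <= j < n - r - 1) (theta`_j)^-1)%:E
     <= kemeny (transition R G) pi j0)%E /\
  (kemeny (transition R G) pi j0
     <= (\sum_(r <= j < n - 1) (theta`_j)^-1 + r%:R / mu`_(n - 2))%:E)%E.
Proof.
rewrite (kemenyE hn hG hmu _ hpi) !lee_fin.
have mu0 := laplacian_eigenvalue_gt0 hn hG hmu.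
have theta0 := laplacian_eigenvalue_gt0 hn hH htheta.
have mu_le := laplacian_eigenvalue_anti hmu.
have low j : (j + r < n)%N -> mu`_(j + r) <= theta`_j.
  by move: hFr => <-; apply: (interlacing_lower hn hG hH hHF hmu htheta).
have upp j : (j + r < n)%N -> theta`_(j + r) <= mu`_j.
  by move: hFr => <-; apply: (interlacing_upper hn hG hH hHF hmu htheta).
have nrE : (n - r - 1 = n - 1 - r)%N by lia.
split.
(* The first [r] terms are at least 1 / mu_0; the others are matched by [low] after a shift by
   [r]. *)
- rewrite (big_cat_nat (leq0n r) hr) /=; apply: lerD.
    have -> : r%:R / mu`_0 = \sum_(0 <= k < r) (mu`_0)^-1.
      by rewrite sumr_const_nat subn0 mulr_natl.
    apply: ler_sum_nat => k /andP[_ kr].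
    by rewrite lef_pV2 ?posrE ?mu_le ?mu0//; lia.
  rewrite nrE -{2}(add0n r) big_addn; apply: ler_sum_nat => j /andP[_ jn].
  by rewrite lef_pV2 ?posrE ?low// ?mu0 ?theta0//; lia.
- rewrite (@big_cat_nat _ _ _ (n - 1 - r)) //=; last by lia.
  apply: lerD.
    rewrite -{2}(add0n r) big_addn; apply: ler_sum_nat => j /andP[_ jn].
    by rewrite lef_pV2 ?posrE ?upp// ?mu0 ?theta0//; lia.
  have -> : r%:R / mu`_(n - 2) = \sum_(n - 1 - r <= k < n - 1) (mu`_(n - 2))^-1.
    by rewrite sumr_const_nat subKn// mulr_natl.
  apply: ler_sum_nat => k /andP[_ kn].
  by rewrite lef_pV2 ?posrE ?mu_le ?mu0//; lia.
Qed.
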